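(* For all sufficiently large integers $w$, there exists a $w$-set system of size at least $\left(\frac{\log w}{8}\right)^{w-\sqrt w}=(\log w)^{w(1-o(1))}$ (where $o(1)\to0$ as $w\to\infty$) which does not contain a $(1/2,1/2)$-robust sunflower.
   Context: A set system on a finite set $X$ is a collection of (distinct) subsets of $X$; it is a $w$-set system if each of its sets has size at most $w$. For $0<p<1$, $\mathcal U(X,p)$ denotes the distribution of a random subset of $X$ in which each element is included independently with probability $p$. A set system $\mathcal F$ on $X$ is $(\alpha,\beta)$-satisfying ($0<\alpha,\beta<1$) if $\Pr_{R\sim\mathcal U(X,\alpha)}[\exists S\in\mathcal F,\ S\subset R]>1-\beta$. For $T\subset X$, the link of $\mathcal F$ at $T$ is $\mathcal F_T=\{S\setminus T:S\in\mathcal F,\ T\subset S\}$. A (nonempty) set system $\mathcal G$ with common intersection $K=\bigcap_{S\in\mathcal G}S$ is an $(\alpha,\beta)$-robust sunflower if (i) $K\notin\mathcal G$, and (ii) $\mathcal G_K$ is $(\alpha,\beta)$-satisfying. $\mathcal F$ contains an $(\alpha,\beta)$-robust sunflower if some subcollection $\mathcal G\subset\mathcal F$ is one. Convention: $\log$ denotes the logarithm in base $1.9$. *)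

(* Defs.v *)
From mathcomp Require Import all_boot all_order all_algebra.
From mathcomp Require Import all_classical all_reals all_analysis.
Set Implicit Arguments.
Unset Strict Implicit.
Unset Printing Implicit Defensive.
Import Order.TTheory GRing.Theory Num.Theory.
Import numFieldNormedType.Exports.
Local Open Scope ring_scope.

Definition log {R : realType} (x : R) : R := ln x / ln (19 / 10).

(* Set systems on the finite set X are the elements of {set {set X}}. *)

Definition w_set_system (X : finType) (w : nat) (F : {set {set X}}) : bool :=
  [forall S in F, (#|S| <= w)%N].

(* Point mass at A of the random subset U(X, p): the events x \in A, for x in
   X, are independent and each has probability p. *)
Definition Umass (R : realType) (X : finType) (p : R) (A : {set X}) : R :=
  \prod_(x : X) (if x \in A then p else 1 - p).

Definition UPr (R : realType) (X : finType) (p : R) (E : pred {set X}) : R :=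
  \sum_(A : {set X} | E A) Umass p A.

Lemma UPr_total (R : realType) (X : finType) (p : R) :
  UPr p (fun _ : {set X} => true) = 1.
Proof.
rewrite /UPr /Umass.
have := @bigA_distr R 0 1 *%R +%R X (fun=> p) (fun=> 1 - p).
rewrite big1 => [/esym E|i _]; last by rewrite /= addrC subrK.
by rewrite -[RHS]E; apply: eq_bigl => A; rewrite inE.
Qed.

Definition satisfying (R : realType) (X : finType) (a b : R)
    (F : {set {set X}}) : bool :=
  [&& 0 < a < 1, 0 < b < 1
    & 1 - b < UPr a (fun A : {set X} => [exists S in F, S \subset A])].

(* The link is kept on the ground set X: deleting T from X does not change the
   probability that a random set contains a member of the link. *)
Definition link (X : finType) (F : {set {set X}}) (T : {set X})
  : {set {set X}} := [set S :\: T | S in F & T \subset S]%SET.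

Definition kernel (X : finType) (G : {set {set X}}) : {set X} :=
  (\bigcap_(S in G) S)%SET.

Definition robust_sunflower (R : realType) (X : finType) (a b : R)
    (G : {set {set X}}) : bool :=
  [&& G != finset.set0, kernel G \notin G & satisfying a b (link G (kernel G))].

Definition contains_robust_sunflower (R : realType) (X : finType) (a b : R)
    (F : {set {set X}}) : Prop :=
  exists2 G : {set {set X}}, G \subset F & robust_sunflower a b G.

(* Main.v *)
Require Import Defs.
From mathcomp Require Import all_boot all_order all_algebra.
From mathcomp Require Import all_classical all_reals all_analysis.
From mathcomp Require Import zify ring lra.
Import Order.TTheory GRing.Theory Num.Theory.
Import numFieldNormedType.Exports.

(** Take w disjoint columns of m points each, and consider only sets that meet
every column in exactly one point: they are the graphs of the words of length
w over an alphabet of m letters.  Two graphs whose words differ in a set D of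
positions have no common point in the columns of D.  A sunflower whose kernel
is not a member has at least two members, so its kernel avoids all the columns
of some such D, and every petal still has a point in each of them.  A random
half of the points meets a given column with probability 1 - 2^-m, and does so
independently for different columns; hence it contains a petal with
probability at most (1 - 2^-m)^#|D|, which is at most 1/2 as soon as
#|D| >= 2^m (UPr_meets, one_sub_inv_expn_le_half, code_no_sunflower).  So the
graphs of any code of minimum distance at least d = 2^m will do.

A maximal code of minimum distance greater than d has at least m^w / (w m)^d
words, because the balls of radius d around its words cover the whole space
(gilbert_varshamov).  Choose m with 8^m <= w < 8^(m+1).  Then d is at most
the cube root of w, so the loss w^d is far below 2^(w - sqrt w); and
8^(m+1) <= 13^m < 1.9^(4m) gives log w / 8 <= m / 2, so the factor 2 between
m and log w / 8, raised to the power w - sqrt w, pays for that loss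
(powR_log_le_code_size).

For the asymptotic form, comparing logarithms of both sides gives
1 - o(1) = (1 - 1 / sqrt w) (1 - ln 8 / ln (log w)). *)

(** * Codes with large minimum distance *)

Definition diffset {I : finType} {J : eqType} (f g : {ffun I -> J}) : {set I} :=
  finset (fun i => f i != g i).

(** Every word at distance at most r + 1 from f is obtained from a word at
distance at most r by writing one letter in one position, so each unit of
radius costs at most a factor #|I| * #|J|. *)
Lemma card_hamming_ball (I J : finType) (f : {ffun I -> J}) (r : nat) :
  (0 < #|I|)%N ->
  (#|finset (fun g => #|diffset f g| <= r)%N| <= (#|I| * #|J|) ^ r)%N.
Proof.
case/card_gt0P => i0 _.
elim: r => [|r IHr].
  rewrite expn0 -(cards1 f); apply/subset_leq_card/fintype.subsetP => g.
  rewrite !inE leqn0 cards_eq0 => /eqP fg; apply/eqP/ffunP => i.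
  have /finset.setP/(_ i) := fg; rewrite !inE => /negbT; rewrite negbK.
  by move=> /eqP.
pose upd (q : {ffun I -> J} * (I * J)) : {ffun I -> J} :=
  [ffun k => if k == q.2.1 then q.2.2 else q.1 k].
have sub : (finset (fun g => (#|diffset f g| <= r.+1)%N) \subset
    upd @: finset.setX (finset (fun g => (#|diffset f g| <= r)%N))
                       [set: I * J]%SET)%SET.
  apply/fintype.subsetP => g; rewrite inE => fg.
  (* Copying the letter of f at a disagreement i brings g closer to f; the
     default i0 serves the case f = g, where the update changes nothing. *)
  pose i := odflt i0 [pick k in diffset f g].
  have card_i : (#|diffset f g :\ i| <= r)%N.
    rewrite /i; case: pickP => [k kfg|fg0] /=.
      by move: fg; rewrite (cardsD1 k) kfg add1n ltnS.
    rewrite (leq_trans (subset_leq_card (finset.subsetDl _ _)))//.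
    by rewrite eq_card0.
  apply/imsetP; exists (upd (g, (i, f i)), (i, g i)).
    rewrite !inE/= andbT (leq_trans _ card_i)//.
    apply/subset_leq_card/fintype.subsetP => k; rewrite !inE !ffunE/=.
    by case: (eqVneq k i) => [->|]//; rewrite eqxx.
  by apply/ffunP => k; rewrite !ffunE/=; case: eqVneq => // ->.
apply: (leq_trans (subset_leq_card sub)).
apply: (leq_trans (leq_imset_card _ _)).
by rewrite cardsX cardsT card_prod expnS mulnC leq_mul2l IHr orbT.
Qed.

(** The Gilbert-Varshamov bound: in a separated code of maximal size, no word
is far from all codewords, so the balls of radius d around the codewords cover
the space. *)
Lemma gilbert_varshamov (I J : finType) (d : nat) :
  (0 < #|I|)%N ->
  exists C : {set {ffun I -> J}},
    {in C &, forall f g, f != g -> (d < #|diffset f g|)%N} /\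
    (#|J| ^ #|I| <= #|C| * (#|I| * #|J|) ^ d)%N.
Proof.
move=> I_gt0.
pose sep (C : {set {ffun I -> J}}) :=
  [forall f in C, forall g in C, (f != g) ==> (d < #|diffset f g|)%N].
have sepP (C : {set {ffun I -> J}}) :
    reflect {in C &, forall f g, f != g -> (d < #|diffset f g|)%N}
            (sep C).
  apply: (iffP forall_inP) => [H f g fC gC fg|H f fC].
    by have /forall_inP/(_ g gC)/implyP/(_ fg) := H f fC.
  by apply/forall_inP => g gC; apply/implyP; exact: H.
have sep0 : sep finset.set0 by apply/sepP => f g; rewrite inE.
case: (@arg_maxnP _ finset.set0 sep (fun C : {set _} => #|C|) sep0)
  => C /sepP Csep Cmax.
exists C; split=> //.
have diffC f g : diffset f g = diffset g f.
  by apply/finset.setP => i; rewrite !inE eq_sym.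
have diffff f : #|diffset f f| = 0%N.
  by apply: eq_card0 => i; rewrite !inE eqxx.
(* A word far from all of C could be added to C. *)
have cover g : (exists2 f, f \in C & #|diffset f g| <= d)%N.
  apply/exists_inP; apply: contraT => /exists_inPn far.
  have gC : g \notin C by apply/negP => /far; rewrite diffff.
  have := Cmax (g |: C)%SET; rewrite cardsU1 gC add1n => maxC.
  suff /maxC : sep (g |: C)%SET by rewrite /= ltnn.
  apply/sepP => f1 f2; rewrite !inE.
  move=> /predU1P[->|f1C] /predU1P[->|f2C]; first by rewrite eqxx.
  - by rewrite diffC ltnNge far.
  - by rewrite ltnNge far.
  - exact: Csep.
rewrite -card_ffun.
have -> : #|{: {ffun I -> J}}| = (\sum_(g : {ffun I -> J}) 1)%N.
  by rewrite sum1_card.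
apply: (@leq_trans (\sum_(g : {ffun I -> J})
                     \sum_(f in C | (#|diffset f g| <= d)%N) 1)%N).
  apply: leq_sum => g _; have [f fC fg] := cover g.
  by rewrite (bigD1 f)//= fC.
rewrite (exchange_big_dep (fun f => f \in C))/=; last by move=> ? ? _ /andP[].
rewrite -[leqRHS]sum_nat_const; apply: leq_sum => f fC.
by rewrite sum1_card fC -cardsE; exact: card_hamming_ball.
Qed.

(** * Independence of the columns of a random subset *)

Local Open Scope ring_scope.

Definition slice {I J : finType} (A : {set I * J}) (i : I) : {set J} :=
  finset (fun j => (i, j) \in A).

(** Under U(I * J, p) the slices are independent with law U(J, p): the mass of
a set is the product of the masses of its slices, and a product of sums over
the slices is a sum over all families of slices. *)
Lemma UPr_slices (R : realType) (I J : finType) (p : R)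
    (P : I -> pred {set J}) :
  UPr p (fun A : {set I * J} => [forall i, P i (slice A i)]) =
  \prod_i UPr p (P i).
Proof.
rewrite /UPr bigA_distr_big_dep.
pose glue (f : {ffun I -> {set J}}) : {set I * J} :=
  finset (fun x => x.2 \in f x.1).
have sliceK f : slice (glue f) =1 f.
  by move=> i; apply/finset.setP => j; rewrite !inE.
rewrite (reindex glue)/=; last first.
  exists (fun A => [ffun i => slice A i]) => [f _|A _].
    by apply/ffunP => i; rewrite ffunE sliceK.
  by apply/finset.setP => -[i j]; rewrite !inE ffunE inE.
apply: eq_big => [f|f _].
  apply/forallP/familyP => H i; have := H i; rewrite sliceK//.
rewrite /Umass pair_big/=; apply: eq_bigr => -[i j] _.
by rewrite inE.
Qed.

Lemma UPr_nonempty (R : realType) (J : finType) (p : R) :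
  UPr p (fun B : {set J} => B != finset.set0) = 1 - (1 - p) ^+ #|J|.
Proof.
rewrite -[X in X - _](UPr_total J p) /UPr [in RHS](bigD1 finset.set0)//= /Umass.
under [in RHS]eq_bigr do rewrite inE.
by rewrite prodr_const addrAC subrr add0r.
Qed.

Lemma Umass_ge0 (R : realType) (X : finType) (p : R) (A : {set X}) :
  0 <= p <= 1 -> 0 <= Umass p A.
Proof.
move=> /andP[p0 p1]; apply: prodr_ge0 => x _.
by case: ifP; rewrite ?subr_ge0.
Qed.

Lemma le_UPr (R : realType) (X : finType) (p : R) (E E' : pred {set X}) :
  0 <= p <= 1 -> subpred E E' -> UPr p E <= UPr p E'.
Proof.
move=> p01 EE'; rewrite /UPr [leRHS](bigID E)/=.
rewrite (eq_bigl E) => [|A]; last first.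
  by rewrite andbC; case: (boolP (E A)) => // /EE'.
by rewrite lerDl sumr_ge0// => A _; exact: Umass_ge0.
Qed.

Lemma UPr_meets (R : realType) (I J : finType) (p : R) (D : {set I}) :
  UPr p (fun A : {set I * J} => [forall i in D, [exists j, (i, j) \in A]]) =
  (1 - (1 - p) ^+ #|J|) ^+ #|D|.
Proof.
pose P i (B : {set J}) := (i \in D) ==> (B != finset.set0).
transitivity (UPr p (fun A : {set I * J} => [forall i, P i (slice A i)])).
  apply: eq_bigl => A; apply: eq_forallb => i; congr (_ ==> _).
  apply/existsP/set0Pn => -[j]; first by exists j; rewrite inE.
  by rewrite inE; exists j.
rewrite UPr_slices -prodr_const [RHS]big_mkcond/=.
apply: eq_bigr => i _; rewrite /P; case: ifP => iD /=; last exact: UPr_total.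
exact: UPr_nonempty.
Qed.

(** With x = 1 / (n + 1), Bernoulli gives (1 + x)^(n + 1) >= 2, whereas
(1 - x)^(n + 1) * (1 + x)^(n + 1) = (1 - x^2)^(n + 1) <= 1. *)
Lemma one_sub_inv_expn_le_half (R : realType) (n : nat) :
  (1 - n.+1%:R^-1 : R) ^+ n.+1 <= 2^-1.
Proof.
set x : R := n.+1%:R^-1.
have x0 : 0 <= x by rewrite invr_ge0.
have x1 : x <= 1 by rewrite invf_le1 ?ltr0n// ler1n.
have bernoulli m : 1 + m%:R * x <= (1 + x) ^+ m.
  elim: m => [|m IHm]; first by rewrite mul0r addr0.
  have m0 : 0 <= m%:R * x * x by rewrite !mulr_ge0.
  rewrite exprS (le_trans _ (ler_wpM2l _ IHm))//; last lra.
  by rewrite -natr1; lra.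
have := bernoulli n.+1; rewrite /x mulfV ?pnatr_eq0// -/x => two.
have prod_le1 : (1 - x) ^+ n.+1 * (1 + x) ^+ n.+1 <= 1.
  rewrite -exprMn exprn_ile1//; first by rewrite mulr_ge0; lra.
  by have := mulr_ge0 x0 x0; lra.
have y0 : 0 <= (1 - x) ^+ n.+1 by rewrite exprn_ge0//; lra.
have := ler_wpM2l y0 two; lra.
Qed.

(** * Graphs of codewords contain no robust sunflower *)

Definition graph {I J : finType} (f : {ffun I -> J}) : {set I * J} :=
  ((fun i => (i, f i)) @: [set: I])%SET.

Lemma in_graph (I J : finType) (f : {ffun I -> J}) i j :
  ((i, j) \in graph f) = (f i == j).
Proof.
apply/imsetP/eqP => [[k _ [-> ->]]//|<-]; by exists i.
Qed.

Lemma graph_inj (I J : finType) : injective (@graph I J).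
Proof.
move=> f g fg; apply/ffunP => i; apply/esym/eqP.
by rewrite -in_graph -fg in_graph.
Qed.

Lemma card_graph (I J : finType) (f : {ffun I -> J}) : #|graph f| = #|I|.
Proof. by rewrite card_imset ?cardsT// => i k []. Qed.

(** The kernel lies below the graphs of two distinct codewords, so it misses
every column in which they disagree, and a random half of the points is
unlikely to meet all of these columns. *)
Lemma code_no_sunflower (R : realType) (I J : finType)
    (C : {set {ffun I -> J}}) :
  {in C &, forall f g, f != g -> (2 ^ #|J| <= #|diffset f g|)%N} ->
  ~ contains_robust_sunflower (1 / 2 : R) (1 / 2 : R) (graph @: C)%SET.
Proof.
move=> Csep [G GC /and3P[/set0Pn[S SG] KG /and3P[_ _]]].
apply/negP; rewrite -leNgt.
have Ksub T : T \in G -> Defs.kernel G \subset T by exact: finset.bigcap_inf.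
(* If S were the only member of G, then the kernel would be S itself. *)
have [T TG TS] : exists2 T, T \in G & T != S.
  apply/exists_inP; apply: contraNT KG => /exists_inPn GS.
  suff -> : Defs.kernel G = S by [].
  apply/eqP; rewrite finset.eqEsubset Ksub//=; apply/finset.bigcapsP => T TG.
  by have := GS T TG; rewrite negbK => /eqP ->.
have /imsetP[f fC Sf] := fintype.subsetP GC _ SG.
have /imsetP[g gC Tg] := fintype.subsetP GC _ TG.
have fg : f != g by apply: contraNneq TS => fg; rewrite Tg Sf fg.
pose D := diffset f g.
have KD i j : i \in D -> (i, j) \notin Defs.kernel G.
  rewrite inE; apply: contraNN => ijK.
  have := fintype.subsetP (Ksub _ SG) _ ijK.
  have := fintype.subsetP (Ksub _ TG) _ ijK.
  by rewrite Sf Tg !in_graph => /eqP -> /eqP ->.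
have half01 : 0 <= (1 / 2 : R) <= 1 by lra.
apply: (@le_trans _ _ (UPr (1 / 2 : R)
    (fun A : {set I * J} => [forall i in D, [exists j, (i, j) \in A]]))).
  apply: le_UPr => // A /exists_inP[_ /imsetP[T' /[!inE] /andP[T'G _] ->] T'A].
  have /imsetP[h _ T'h] := fintype.subsetP GC _ T'G.
  apply/forall_inP => i iD; apply/existsP; exists (h i).
  by apply: (fintype.subsetP T'A); rewrite inE KD//= T'h in_graph.
rewrite UPr_meets.
have -> : (1 : R) - 1 / 2 = 2^-1 by lra.
rewrite exprVn -natrX.
have := Csep f g fC gC fg; rewrite -/D.
have : (0 < 2 ^ #|J|)%N by rewrite expn_gt0.
case: (2 ^ #|J|)%N => // n _ nD.
apply: le_trans (one_sub_inv_expn_le_half R n).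
have : (n.+1%:R^-1 : R) <= 1 by rewrite invf_le1 ?ltr0n// ler1n.
have : 0 <= (n.+1%:R^-1 : R) by rewrite invr_ge0.
by move: (_^-1) => x x0 x1; apply: ler_wiXn2l => //; lra.
Qed.

(** * The size of the code *)

(** This is the logarithm of w < 8 * 8^m <= 13^m <= (19/10)^(4 m), where the
second inequality holds from m = 5 on. *)
Lemma log_le_half (R : realType) (w m : nat) :
  (0 < w)%N -> (4 < m)%N -> (w < 8 ^ m.+1)%N -> log w%:R / 8 <= m%:R / 2 :> R.
Proof.
move=> w0 m4 wm; rewrite /log.
have pow_le : 8 ^+ m.+1 <= 13 ^+ m :> R.
  elim: m m4 {wm} => // m IHm; rewrite leq_eqVlt => /predU1P[<-|/IHm {}IHm].
    by rewrite !exprS expr0; lra.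
  rewrite exprS [leRHS]exprS ler_pM// ?exprn_ge0//; lra.
have ln0 : 0 < ln (19 / 10 : R) by rewrite ln_gt0//; lra.
have : ln (w%:R : R) <= ln (19 / 10) * (4 * m%:R).
  have -> : ln (19 / 10 : R) * (4 * m%:R) = ln ((19 / 10) ^+ (4 * m)).
    by rewrite lnXn; [rewrite -[RHS]mulr_natr natrM|lra].
  rewrite ler_ln ?posrE ?ltr0n//.
  apply: (@le_trans _ _ (13 ^+ m)).
    by rewrite (le_trans _ pow_le)// -natrX ler_nat ltnW.
  by rewrite exprM lerXn2r ?nnegrE//; lra.
rewrite -ler_pdivrMl// mulrC => ?; lra.
Qed.

(** The hypothesis on c is the conclusion of the Gilbert-Varshamov bound with
distance d = 2^m.  Since d^3 = 8^m <= w < 8^(m + 1), both d <= sqrt w and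
w^d <= 2^(3 (m + 1) d) <= 2^(w - sqrt w), so that
(log w / 8)^(w - sqrt w) * w^d <= (m / 2)^(w - sqrt w) * 2^(w - sqrt w)
= m^(w - sqrt w) <= m^(w - d). *)
Lemma powR_log_le_code_size (R : realType) (w m c : nat) :
  (4 < m)%N -> (8 ^ m <= w < 8 ^ m.+1)%N ->
  (m ^ w <= c * (w * m) ^ (2 ^ m))%N ->
  (log w%:R / 8) `^ (w%:R - Num.sqrt w%:R) <= c%:R :> R.
Proof.
move=> m4 /andP[mw wm] mc; set d := (2 ^ m)%N in mc *.
have d0 : (0 < d)%N by rewrite expn_gt0.
have e8 : (8 ^ m = d * d * d)%N by rewrite -!expnMn.
have w0 : (0 < w)%N by rewrite (leq_trans _ mw)// expn_gt0.
have dw : (d * d <= w)%N by nia.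
have exp_le : (6 * m.+1 <= d * d)%N.
  rewrite /d -expnMn; elim: m m4 {mw wm mc d d0 e8 dw} => // m IHm.
  by rewrite leq_eqVlt => /predU1P[<-//|/IHm]; rewrite !expnS; lia.
have wd_le : (w ^ d <= 2 ^ (3 * m.+1 * d))%N.
  by rewrite expnM leq_exp2r// (leq_trans (ltnW wm))// expnM.
set s : R := Num.sqrt w%:R.
have ss : s * s = w%:R by rewrite -expr2 sqr_sqrtr.
have s0 : 0 <= s by exact: sqrtr_ge0.
have ds : d%:R <= s.
  rewrite -(@ler_pXn2r _ 2) ?nnegrE// !expr2 ss -natrM ler_nat//.
have d2 : 2 <= d%:R :> R.
  by rewrite (ler_nat _ 2) /d -{1}(expn1 2) leq_exp2l// (leq_trans _ m4).
have sw : s * 2 <= w%:R by rewrite -ss ler_wpM2l//; lra.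
have mdw : (3 * m.+1 * d)%N%:R <= w%:R - s :> R.
  have : (3 * m.+1 * d)%:R * 2 <= w%:R :> R.
    by rewrite -natrM ler_nat; nia.
  lra.
set e : R := w%:R - s.
have e0 : 0 <= e by rewrite /e; lra.
have m_gt0 : (0 < m)%N by exact: leq_trans m4.
have m0 : 0 < m%:R :> R by rewrite ltr0n.
have m1 : 1 <= m%:R :> R by rewrite ler1n.
have log0 : 0 <= log (w%:R : R) / 8.
  rewrite /log divr_ge0// divr_ge0// ln_ge0//; last lra.
  by rewrite ler1n.
have half : (log w%:R / 8) `^ e <= (m%:R / 2) `^ e.
  apply: ge0_ler_powR; rewrite ?nnegrE//.
  exact: log_le_half.
have two : w%:R ^+ d <= 2 `^ e :> R.
  rewrite (@le_trans _ _ (2 `^ (3 * m.+1 * d)%N%:R))//.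
    by rewrite powR_mulrn// -!natrX ler_nat.
  by rewrite ler_powR// ler1n.
have split_m : (m%:R / 2) `^ e * 2 `^ e = m%:R `^ e :> R.
  by rewrite -powRM ?divr_ge0// divfK.
have wmd0 : 0 < ((w * m) ^ d)%:R :> R.
  by rewrite ltr0n expn_gt0 muln_gt0 w0 m_gt0.
rewrite -(ler_pM2r wmd0) -natrM.
apply: (@le_trans _ _ (m ^ w)%:R); last by rewrite ler_nat.
rewrite expnMn natrM mulrA.
apply: (@le_trans _ _ (m%:R `^ e * m%:R ^+ d)).
  rewrite !natrX ler_pM2r ?exprn_gt0// -split_m.
  by rewrite ler_pM ?powR_ge0 ?exprn_ge0.
rewrite -powR_mulrn ?(ltW m0)// -powRD; last by rewrite (gt_eqF m0) implybT.
by rewrite natrX -powR_mulrn ?(ltW m0)// ler_powR// /e; lra.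
Qed.

(** * The exponent w (1 - o(1)) *)

Local Open Scope classical_set_scope.

Lemma cvgry_ln (R : realType) (u : nat -> R) :
  u n @[n --> \oo] --> +oo -> ln (u n) @[n --> \oo] --> +oo.
Proof.
move=> /cvgryPge uoo; apply/cvgryPge => A.
near=> n; have un : expR A <= u n by near: n; exact: uoo.
have un0 : 0 < u n by rewrite (lt_le_trans (expR_gt0 A)).
by rewrite -(expRK A) ler_ln ?posrE ?expR_gt0.
Unshelve. all: by end_near. Qed.

Lemma cvgry_sqrt (R : realType) (u : nat -> R) :
  u n @[n --> \oo] --> +oo -> Num.sqrt (u n) @[n --> \oo] --> +oo.
Proof.
move=> /cvgryPge uoo; apply/cvgryPge => A.
near=> n; have un : A ^+ 2 <= u n by near: n; exact: uoo.
rewrite (le_trans (ler_norm A))// -sqrtr_sqr ler_wsqrtr//.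
Unshelve. all: by end_near. Qed.

Lemma cvgry_log (R : realType) : log (n%:R : R) @[n --> \oo] --> +oo.
Proof.
have ln0 : 0 < ln (19 / 10 : R) by rewrite ln_gt0//; lra.
have /cvgryPge lnoo := cvgry_ln _ _ (@cvgr_idn R).
apply/cvgryPge => A; near=> n.
by rewrite /log ler_pdivlMr//; near: n; exact: lnoo.
Unshelve. all: by end_near. Qed.

Lemma powR_log_asymptotic (R : realType) :
  exists2 o : nat -> R, o w @[w --> \oo] --> (0 : R)
    & exists w1 : nat, forall w : nat, (w1 <= w)%N ->
        (log w%:R / 8) `^ (w%:R - Num.sqrt w%:R)
        = log w%:R `^ (w%:R * (1 - o w)) :> R.
Proof.
exists (fun w => 1 - (1 - (Num.sqrt w%:R)^-1) * (1 - ln 8 * (ln (log w%:R))^-1)).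
  have inv_cvg (u : nat -> R) :
      u n @[n --> \oo] --> +oo -> (u n)^-1 @[n --> \oo] --> (0 : R).
    move=> uoo; apply/gtr0_cvgV0 => //.
    by move/cvgryPgt: uoo; exact.
  have s0 := inv_cvg _ (cvgry_sqrt _ _ (@cvgr_idn R)).
  have l0 := inv_cvg _ (cvgry_ln _ _ (@cvgry_log R)).
  have -> : (0 : R) = 1 - (1 - 0) * (1 - ln 8 * 0) by ring.
  apply: cvgB; first exact: cvg_cst.
  apply: cvgM; apply: cvgB; try exact: cvg_cst; first exact: s0.
  by apply: cvgM; [exact: cvg_cst|exact: l0].
have /cvgryPgt/(_ 1) [w1 _ log_gt1] := @cvgry_log R.
exists w1.+1 => w ww1.
have L1 : 1 < log (w%:R : R) by apply: log_gt1 => /=; exact: ltnW.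
have lnL0 : ln (log (w%:R : R)) != 0 by rewrite gt_eqF// ln_gt0.
have w0 : 0 < w%:R :> R by rewrite ltr0n (leq_ltn_trans _ ww1).
have s0 : Num.sqrt (w%:R : R) != 0 by rewrite gt_eqF// sqrtr_gt0.
rewrite /powR ifF; last by rewrite gt_eqF//; lra.
rewrite ifF; last by rewrite gt_eqF//; lra.
congr expR; rewrite ln_div ?posrE//; last lra.
rewrite subKr.
have -> : w%:R - Num.sqrt w%:R = w%:R * (1 - (Num.sqrt w%:R)^-1) :> R.
  by rewrite mulrBr mulr1 -[X in X / _](sqr_sqrtr (ltW w0)) expr2 mulfK.
by rewrite -!mulrA; congr (_ * (_ * _)); rewrite mulrBl mul1r divfK.
Qed.

Theorem lemma3p1 (R : realType) :
  (exists w0 : nat, forall w : nat, (w0 <= w)%N ->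
     exists (X : finType) (F : {set {set X}}),
       [/\ w_set_system w F,
           (log w%:R / 8) `^ (w%:R - Num.sqrt w%:R) <= #|F|%:R :> R
         & ~ contains_robust_sunflower (1 / 2 : R) (1 / 2 : R) F])
  /\ (exists2 o : nat -> R, o w @[w --> \oo] --> (0 : R)
        & exists w1 : nat, forall w : nat, (w1 <= w)%N ->
            (log w%:R / 8) `^ (w%:R - Num.sqrt w%:R)
            = log w%:R `^ (w%:R * (1 - o w)) :> R).
Proof.
split; last exact: powR_log_asymptotic.
(* This threshold makes m at least 5. *)
exists (8 ^ 5)%N => w w_ge.
have w_gt0 : (0 < w)%N by rewrite (leq_trans _ w_ge)// expn_gt0.
pose m := trunc_log 8 w.
have m_gt4 : (4 < m)%N by exact: trunc_log_max.
have cardI_gt0 : (0 < #|'I_w|)%N by rewrite card_ord.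
have [C [Csep Ccard]] := gilbert_varshamov 'I_w 'I_m (2 ^ m) cardI_gt0.
rewrite !card_ord in Ccard.
exists ('I_w * 'I_m)%type, (graph @: C)%SET; split.
- by apply/forall_inP => _ /imsetP[f _ ->]; rewrite card_graph card_ord.
- rewrite card_imset; last exact: graph_inj.
  by apply: (powR_log_le_code_size _ _ m) => //; exact: trunc_log_bounds.
- apply: code_no_sunflower => f g fC gC fg.
  by rewrite card_ord ltnW// Csep.
Qed.
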